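(* Let $X$ be the (stationary) Widom--Rowlinson model on $\mathbb{R}^2$ with parameters $\lambda>0$, $r>0$, $\gamma\in\mathbb{R}$. Then the Voronoi tessellation $S=S_{\rm V}(X)$ satisfies $\mathbb{E}[\exp(\alpha|S\cap B_1|)]<\infty$ for all $\alpha\in\mathbb{R}$.
   Context: $B_1\subset\mathbb{R}^2$ is the closed unit disk centered at the origin and $B_r(x)$ is the ball of radius $r>0$ centered at $x\in\mathbb{R}^2$. For a tessellation $S$ and measurable $A\subset\mathbb{R}^2$, $|S\cap A|=\nu_1(S\cap A)$ is the total edge length in $A$, $\nu_1$ being one-dimensional Hausdorff measure; for full-dimensional sets $|\cdot|$ is Lebesgue measure. A Gibbs point process with Hamiltonian $H$, intensity $\lambda>0$ and system parameter $\gamma\in\mathbb{R}$ is a point process $X$ on $\mathbb{R}^2$ such that for every bounded measurable $B\subset\mathbb{R}^2$ the conditional law of $X_B=X\cap B$ given $X_{B^{\rm c}}=X\cap(\mathbb{R}^2\setminus B)$ is $$\mathcal{P}_B(\mathrm{d}X_B)\,\frac{\exp(-\gamma H(X_BX_{B^{\rm c}}))}{\int\mathcal{P}_B(\mathrm{d}X'_B)\exp(-\gamma H(X'_BX_{B^{\rm c}}))},$$ where $\mathcal{P}_B$ is the law of a Poisson point process on $B$ with intensity $\lambda$ and $X_BX_{B^{\rm c}}=X_B\cup X_{B^{\rm c}}$. The Widom--Rowlinson model is the case $H(X)=\big|\bigcup_{X_i\in X}B_r(X_i)\big|$. For infinite boundary configurations the expression is understood via the energy relative to the boundary configuration, i.e.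 $H(X_BX_{B^{\rm c}})$ is replaced by $\big|\bigcup_{x\in X_B}B_r(x)\setminus\bigcup_{x\in X_{B^{\rm c}}}B_r(x)\big|$ in numerator and denominator. $X$ is taken to be a stationary point process (with intensity in $(0,\infty)$) with these conditional probabilities. The Voronoi tessellation of $X=\{X_i\}_{i\in I}$ is $S_{\rm V}(X)=\bigcup_{i\in I}\partial\{x\in\mathbb{R}^2: |x-X_i|=\inf_{j\in I}|x-X_j|\}$, where $\partial$ denotes the boundary. *)

(* Defs.v *)
From HB Require Import structures.
From mathcomp Require Import all_boot all_order all_algebra.
From mathcomp Require Import all_classical all_reals all_analysis.
From mathcomp Require Import measurable_realfun.

Set Implicit Arguments.
Unset Strict Implicit.
Unset Printing Implicit Defensive.

Import Order.TTheory GRing.Theory Num.Theory.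
Import numFieldNormedType.Exports.

Local Open Scope classical_set_scope.
Local Open Scope ring_scope.

Section Plane.
Context {R : realType}.
Implicit Types (x y : R * R) (A : set (R * R)).

(* The norm of the normed module R * R is the sup norm. It induces the right
   topology and the right bounded sets, but not the Euclidean distance. *)
Definition eucl_dist x y : R :=
  Num.sqrt ((x.1 - y.1) ^+ 2 + (x.2 - y.2) ^+ 2).

Definition disk x (r : R) : set (R * R) := [set y | eucl_dist x y <= r].

Definition area : set (R * R) -> \bar R :=
  (@lebesgue_measure R \x @lebesgue_measure R)%E.

Definition boundary A : set (R * R) := closure A `\` A°.

(* The point 0 is added because ereal_sup set0 = -oo. *)
Definition diameter A : \bar R :=
  ereal_sup ([set 0%E] `|` [set (eucl_dist p.1 p.2)%:E | p in A `*` A]).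

Definition hausdorff1_delta (delta : R) A : \bar R :=
  ereal_inf [set (\sum_(0 <= i <oo) diameter (U i))%E |
    U in [set U : (set (R * R))^nat |
      A `<=` \bigcup_i U i /\ forall i, (diameter (U i) <= delta%:E)%E]].

Definition hausdorff1 A : \bar R :=
  ereal_sup [set hausdorff1_delta delta A | delta in [set delta : R | 0 < delta]].

Definition voronoi_cell A x : set (R * R) :=
  [set z | eucl_dist z x = inf [set eucl_dist z y | y in A]].

Definition voronoi A : set (R * R) :=
  \bigcup_(x in A) boundary (voronoi_cell A x).

End Plane.

Definition locally_finite (R : realType) (A : set (R * R)) :=
  forall B : set (R * R), bounded_set B -> finite_set (A `&` B).

(* Point processes are simple here, so their realisations are sets. *)
Record config (R : realType) := Config {
  points :> set (R * R);
  points_lf : locally_finite points }.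

Section ConfigSpace.
Context {R : realType}.
Implicit Types (w : config R) (B : set (R * R)).

Lemma locally_finite0 : locally_finite (set0 : set (R * R)).
Proof. by move=> B _; rewrite set0I. Qed.

HB.instance Definition _ := gen_eqMixin (config R).
HB.instance Definition _ := gen_choiceMixin (config R).
HB.instance Definition _ := isPointed.Build (config R) (Config locally_finite0).

Definition count_in B w : \bar R := counting (points w `&` B).

Definition count_event B (n : nat) : set (config R) :=
  [set w | count_in B w = n%:R%:E].

Definition count_events : set (set (config R)) :=
  [set E | exists B n, [/\ measurable B, bounded_set B & E = count_event B n]].

HB.instance Definition _ :=
  Measurable.copy (config R) (g_sigma_algebraType count_events).

Lemma locally_finite_restrict w B : locally_finite (points w `&` B).
Proof.
move=> C bC; apply: sub_finite_set (points_lf w bC).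
by move=> x [[]].
Qed.

Definition restrict_config B w : config R := Config (locally_finite_restrict w B).

Definition translate (v : R * R) w : set (R * R) := [set x + v | x in points w].

Lemma locally_finite_translate v w : locally_finite (translate v w).
Proof.
move=> B bB.
have bBv : bounded_set [set x - v | x in B].
  have [M [Mr HM]] := bB.
  exists (M + `|v|); split; first exact: num_real.
  move=> N MN _ [x Bx <-] /=.
  rewrite (le_trans (ler_normB _ _))// -lerBrDr; apply: HM => //.
  by rewrite ltrBrDr.
apply: sub_finite_set (finite_image (fun x => x + v) (points_lf w bBv)).
move=> _ [[x wx <-] Bxv]; exists x => //; split=> //.
by exists (x + v) => //; rewrite addrK.
Qed.

Definition shift_config (v : R * R) w : config R :=
  Config (locally_finite_translate v w).

End ConfigSpace.

Section PointProcess.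
Local Open Scope ereal_scope.
Context {R : realType}.

(* The library's poisson_pmf equals 1 at rate 0, whereas a rate 0 is needed here
   to say that the process has no point outside of B. *)
Definition poisson_weight (m : R) (n : nat) : R :=
  (m ^+ n / n`!%:R * expR (- m))%R.

Definition poisson_process_law (lambda : R) (B : set (R * R))
    (Pi : probability (config R) R) : Prop :=
  (forall (A : set (R * R)) (n : nat), measurable A ->
    Pi (count_event A n)
    = (poisson_weight (lambda * fine (area (A `&` B))) n)%:E) /\
  (forall (k : nat) (A : 'I_k -> set (R * R)) (n : 'I_k -> nat),
    (forall i, measurable (A i)) -> trivIset setT A ->
    Pi (\bigcap_i count_event (A i) (n i))
    = \prod_(i < k) Pi (count_event (A i) (n i))).

(* kappa is a (regular) version of the conditional law of Y given Z. *)
Definition conditional_law (d d1 d2 : measure_display) (T : measurableType d)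
    (T1 : measurableType d1) (T2 : measurableType d2) (P : probability T R)
    (Y : T -> T1) (Z : T -> T2) (kappa : T2 -> set T1 -> \bar R) : Prop :=
  forall E : set T1, measurable E ->
    measurable_fun setT (kappa ^~ E) /\
    forall F : set T2, measurable F ->
      P (Y @^-1` E `&` Z @^-1` F) = \int[P]_(t in Z @^-1` F) kappa (Z t) E.

(* [energy xi om] is the energy of xi relative to the boundary
   configuration om. *)
Definition boltzmann (gamma : R) (energy : config R -> config R -> \bar R)
    (om xi : config R) : \bar R :=
  expeR (- (gamma%:E * energy xi om)).

Definition gibbs_kernel (Pi : probability (config R) R) (gamma : R)
    (energy : config R -> config R -> \bar R)
    (om : config R) (E : set (config R)) : \bar R :=
  (\int[Pi]_(xi in E) boltzmann gamma energy om xi) *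
  (\int[Pi]_xi boltzmann gamma energy om xi)^-1.

(* The Poisson law Pi on B exists and is unique, so quantifying it
   existentially only names it. *)
Definition gibbs_process (d : measure_display) (T : measurableType d)
    (P : probability T R) (X : T -> config R) (lambda gamma : R)
    (energy : config R -> config R -> \bar R) : Prop :=
  forall B : set (R * R), measurable B -> bounded_set B ->
    exists Pi : probability (config R) R,
      poisson_process_law lambda B Pi /\
      conditional_law P (fun t => restrict_config B (X t))
        (fun t => restrict_config (~` B) (X t)) (gibbs_kernel Pi gamma energy).

Definition stationary (d : measure_display) (T : measurableType d)
    (P : probability T R) (X : T -> config R) : Prop :=
  forall (v : R * R) (E : set (config R)), measurable E ->
    P [set t | E (shift_config v (X t))] = P [set t | E (X t)].

Definition intensity (d : measure_display) (T : measurableType d)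
    (P : probability T R) (X : T -> config R) : \bar R :=
  \int[P]_t count_in (`[0%R, 1%R]%classic `*` `[0%R, 1%R]%classic) (X t).

Definition wr_energy (r : R) (xi om : config R) : \bar R :=
  area ((\bigcup_(x in points xi) disk x r) `\`
        (\bigcup_(x in points om) disk x r)).

Definition widom_rowlinson (d : measure_display) (T : measurableType d)
    (P : probability T R) (X : T -> config R) (lambda r gamma : R) : Prop :=
  [/\ measurable_fun setT X,
      stationary P X,
      0 < intensity P X < +oo
    & gibbs_process P X lambda gamma (wr_energy r)].

End PointProcess.

(* Main.v *)
Require Import Defs.
From mathcomp Require Import all_boot all_order all_algebra.
From mathcomp Require Import finmap.
From mathcomp Require Import all_classical all_reals all_analysis.
From mathcomp Require Import measurable_realfun ring lra.
Set Implicit Arguments.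
Unset Strict Implicit.
Unset Printing Implicit Defensive.
Import Order.TTheory GRing.Theory Num.Theory.
Import numFieldNormedType.Exports.
Local Open Scope classical_set_scope.
Local Open Scope ring_scope.

(** Suppose that [X] has no point in the open disk of radius [n] about the origin
    but has one in the open disk of radius [n + 1].  A nucleus whose cell meets
    the unit disk then lies in the annulus between the radii [n] and [n + 3]
    ([nucleus_close]).  Each cell contributes at most the length 16 to the
    tessellation in the unit disk: the normals to the boundary of a cell split into
    four sectors, and the boundary points with normals in one sector form a
    1-Lipschitz graph over a coordinate axis, because every boundary point comes
    with a half-plane containing the cell ([sector_lipschitz]).  So the length is at
    most 16 times the number of points in the annulus
    ([hausdorff1_voronoi_le]).

    It remains to compare an emptiness probability of order [exp (- p n^2)] with
    exponential moments over an annulus, whose area is only [O(n^(3/2))] by a crude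
    estimate.  Let [D] be the small disk and [A] the annulus.  The relative energy
    of a configuration with [k] points lies between [0] and [4 r^2 k], so with
    [g = 4 r^2 |gamma|] the Boltzmann weight lies between [exp (- g k)] and
    [exp (g k)].  One application of the conditional law in [D `|` A] bounds the
    probability of having no point in [D] and [k] points in [A] by a
    Poisson expression: in the numerator the [k] points of [A] cost at most
    [exp (g k)], and the partition function is at least the Poisson
    expectation of [exp (- g N)], [N] being the number of points in [D `|` A].
    The factor [exp (- lambda |D|)] of the empty disk is thus only partly
    compensated, and summing over [k] against [exp (c k)] leaves
    [exp (lambda (|A| exp (c + g) - |D| exp (- g)))]
    ([gibbs_count_exp_moment]), which is summable over [n].

    The tessellation length and the Boltzmann weight are integrated without a
    proof that they are measurable.  The integral of a nonnegative function is a
    supremum over the simple functions below it, hence monotone for arbitrary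
    integrands ([ge0_le_integral_nonmeas]), and all the comparisons are made with
    measurable bounds. *)

(** * Monotonicity without measurability *)

Lemma ge0_le_integral_nonmeas d (T : measurableType d) (R : realType)
    (mu : {measure set T -> \bar R}) (D : set T) (f g : T -> \bar R) :
  (forall x, D x -> 0 <= f x)%E -> (forall x, D x -> f x <= g x)%E ->
  (\int[mu]_(x in D) f x <= \int[mu]_(x in D) g x)%E.
Proof.
move=> f0 fg.
have g0 x : D x -> (0 <= g x)%E by move=> Dx; exact: le_trans (f0 x Dx) (fg x Dx).
rewrite !ge0_integralE//; apply: ge_ereal_sup => _ [h hf <-].
apply: ereal_sup_ubound; exists h => // x; apply: le_trans (hf x) _.
by rewrite /patch; case: ifPn => // /set_mem; exact: fg.
Qed.

Lemma lebesgue_measure_mono (R : realType) (A B : set R) : A `<=` B ->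
  (lebesgue_measure A <= lebesgue_measure B)%E.
Proof. by move=> AB; exact: le_mu_ext. Qed.

Lemma area_mono (R : realType) (A B : set (R * R)) : A `<=` B ->
  (area A <= area B)%E.
Proof.
move=> AB; apply: ge0_le_integral_nonmeas => x _ /=; first exact: measure_ge0.
by apply: lebesgue_measure_mono; exact: le_xsection.
Qed.

(** * Cells of the Voronoi tessellation *)

Section Cells.
Context {R : realType}.
Implicit Types (x y z w : R * R) (A : set (R * R)).

Definition sqnorm x : R := x.1 ^+ 2 + x.2 ^+ 2.

Lemma sqnorm_ge0 x : 0 <= sqnorm x.
Proof. by rewrite addr_ge0// sqr_ge0. Qed.

Lemma sqnormN x : sqnorm (- x) = sqnorm x.
Proof. by rewrite /sqnorm /= !sqrrN. Qed.

Lemma eucl_distE x y : eucl_dist x y = Num.sqrt (sqnorm (x - y)).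
Proof. by []. Qed.

Lemma eucl_dist_ge0 x y : 0 <= eucl_dist x y.
Proof. exact: sqrtr_ge0. Qed.

Lemma le_eucl_dist z x y :
  (eucl_dist z x <= eucl_dist z y) = (sqnorm (z - x) <= sqnorm (z - y)).
Proof. by rewrite !eucl_distE ler_sqrt// sqnorm_ge0. Qed.

Lemma voronoi_cellP A x z : A x ->
  voronoi_cell A x z <-> forall y, A y -> sqnorm (z - x) <= sqnorm (z - y).
Proof.
move=> Ax; pose D := [set eucl_dist z y | y in A].
have lbD : lbound D 0 by move=> _ [y _ <-]; exact: eucl_dist_ge0.
have hlD : has_lbound D by exists 0.
have neD : D !=set0 by exists (eucl_dist z x), x.
split=> [h y Ay|h].
  by rewrite -le_eucl_dist [leLHS]h; apply: ge_inf => //; exists y.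
apply/eqP; rewrite eq_le; apply/andP; split; last by apply: ge_inf => //; exists x.
by apply: lb_le_inf => // _ [y Ay <-]; rewrite le_eucl_dist; exact: h.
Qed.

(** The triangle inequality, squared; it rests on Lagrange's identity. *)
Lemma sqnormD_lt x y (s t : R) : 0 <= s -> 0 <= t ->
  sqnorm x <= s ^+ 2 -> sqnorm y < t ^+ 2 -> sqnorm (x + y) < (s + t) ^+ 2.
Proof.
case: x => a b; case: y => c e s0 t0; rewrite /sqnorm /= => hx hy.
have h : a * c + b * e <= s * t.
  apply: (le_trans (ler_norm _)); rewrite -ler_sqr ?nnegrE ?mulr_ge0 ?normr_ge0//.
  rewrite real_normK ?num_real// exprMn.
  apply: (@le_trans _ _ ((a ^+ 2 + b ^+ 2) * (c ^+ 2 + e ^+ 2))).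
    rewrite -subr_ge0 (_ : _ - _ = (a * e - b * c) ^+ 2) ?sqr_ge0//; ring.
  by apply: ler_pM => //; rewrite ?addr_ge0 ?sqr_ge0// ltW.
nra.
Qed.

Lemma sqnormB_continuous x : continuous (fun w : R * R => sqnorm (w - x)).
Proof.
move=> w; apply: cvgD; rewrite expr2; under eq_fun do rewrite expr2.
  by apply: cvgM; (apply: cvgB; [exact: cvg_fst|exact: cvg_cst]).
by apply: cvgM; (apply: cvgB; [exact: cvg_snd|exact: cvg_cst]).
Qed.

Lemma near_sqnorm_lt x y z : sqnorm (z - x) < sqnorm (z - y) ->
  \forall w \near z, sqnorm (w - x) < sqnorm (w - y).
Proof.
move=> h.
have hc : (fun w => sqnorm (w - y) - sqnorm (w - x)) w @[w --> z] -->
    sqnorm (z - y) - sqnorm (z - x) by apply: cvgB; exact: sqnormB_continuous.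
have := cvgr_gt _ hc 0; rewrite subr_gt0 => /(_ (nbhs_filter z) h).
by apply: filterS => w; rewrite subr_gt0.
Qed.

(** Near [z] the distance to [x] stays below [sqrt K <= K], so only the nuclei in
    the ball [F] of radius [K + 1] for the sup norm compete with [x]; they are
    finitely many, and each strict comparison persists near [z]. *)
Lemma voronoi_cell_interior A x z : locally_finite A -> A x ->
  (forall y, A y -> y <> x -> sqnorm (z - x) < sqnorm (z - y)) ->
  \forall w \near z, voronoi_cell A x w.
Proof.
move=> lfA Ax h.
pose K := sqnorm (z - x) + 1.
have K1 : 1 <= K by rewrite lerDr sqnorm_ge0.
pose F := A `&` ball z (K + 1).
have finF : finite_set F.
  apply: lfA; exists (`|z| + (K + 1)); split; first exact: num_real.
  move=> M hM y [zy1 zy2] /=; rewrite (le_trans _ (ltW hM))//.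
  rewrite -[y](subrK z) addrC; apply: (le_trans (ler_normD _ _)); rewrite lerD2l.
  rewrite prod_normE /= ge_max; apply/andP.
  by rewrite -[X in X <= _]normrN -[X in _ /\ X <= _]normrN !opprB !ltW.
have nearF : \forall w \near z, forall y, F y -> sqnorm (w - x) <= sqnorm (w - y).
  have /finite_seqP[s Fs] := finF.
  have : forall y, y \in s -> A y.
    by move=> y ys; have /seteqP[_ /(_ y ys)[]] := Fs.
  rewrite {}Fs; elim: s => [_|y s IH sA]; first by near=> w.
  have {}IH : \forall w \near z, forall y, y \in s -> sqnorm (w - x) <= sqnorm (w - y).
    by apply: IH => u us; apply: sA; rewrite in_cons us orbT.
  have [->|/eqP yx] := eqVneq y x.
    by near=> w => u; rewrite /= in_cons => /orP[/eqP->//|]; move: u; near: w.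
  have hy := near_sqnorm_lt (h _ (sA _ (mem_head _ _)) yx).
  near=> w => u; rewrite /= in_cons => /orP[/eqP->|].
    by apply: ltW; near: w.
  by move: u; near: w.
have nearK : \forall w \near z, sqnorm (w - x) < K.
  have hc := @sqnormB_continuous x z.
  by have := cvgr_lt _ hc K; apply; rewrite ltrDl.
near=> w; apply/voronoi_cellP => // y Ay.
have [Fy|nFy] := pselect (F y).
  by move: y Fy {Ay}; near: w.
have wz : ball z 1 w by near: w; exact: nbhsx_ballx.
have wK : sqnorm (w - x) < K by near: w.
apply: le_trans (ltW wK) _.
have far (a b c : R) : `|a - b| < 1 -> K + 1 <= `|a - c| -> K <= (b - c) ^+ 2.
  move=> ab ac; have bc : K <= `|b - c|.
    have := ler_normD (a - b) (b - c); rewrite subrKA; lra.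
  rewrite -real_normK ?num_real//; nra.
have [wz1 wz2] := wz.
have [z1|z1] := ltP `|z.1 - y.1| (K + 1); last first.
  by rewrite (le_trans (far _ _ _ wz1 z1))// lerDl sqr_ge0.
have [z2|z2] := ltP `|z.2 - y.2| (K + 1); last first.
  by rewrite (le_trans (far _ _ _ wz2 z2))// lerDr sqr_ge0.
by case: nFy; split.
Unshelve. all: by end_near.
Qed.

(** If no second nucleus were at the same distance, the point would be interior to
    the cell; and cells are closed. *)
Lemma boundary_voronoi_cell A x z : locally_finite A -> A x ->
  boundary (voronoi_cell A x) z ->
  voronoi_cell A x z /\
  exists y, [/\ A y, y <> x & sqnorm (z - x) = sqnorm (z - y)].
Proof.
move=> lfA Ax [cz iz].
have Cz : voronoi_cell A x z.
  apply/voronoi_cellP => // y Ay; rewrite leNgt; apply/negP => /near_sqnorm_lt yx.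
  have [w [Cw wyx]] := cz _ yx.
  by have := (voronoi_cellP w Ax).1 Cw y Ay; rewrite leNgt wyx.
split=> //; apply: contrapT => hy; apply: iz.
apply: voronoi_cell_interior => // y Ay yx.
rewrite lt_neqAle; apply/andP; split; last exact: (voronoi_cellP z Ax).1.
by apply/eqP => e; apply: hy; exists y.
Qed.

(** For a nucleus [x] whose cell meets the unit disk at [z],
    [|x| <= |z| + |x - z| <= |z| + |y - z| <= |y| + 2 |z|]. *)
Lemma nucleus_close A (rho : R) x y z : 0 <= rho -> A x -> A y ->
  sqnorm y < rho ^+ 2 -> voronoi_cell A x z -> sqnorm z <= 1 ->
  sqnorm x < (rho + 2) ^+ 2.
Proof.
move=> rho0 Ax Ay yrho Cz z1.
have z1' : sqnorm z <= 1 ^+ 2 by rewrite expr1n.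
have ny : sqnorm (- y) < rho ^+ 2 by rewrite sqnormN.
have zx : sqnorm (x - z) < (1 + rho) ^+ 2.
  rewrite -sqnormN opprB; apply: le_lt_trans ((voronoi_cellP z Ax).1 Cz y Ay) _.
  exact: sqnormD_lt z1' ny.
have := sqnormD_lt ler01 (addr_ge0 ler01 rho0) z1' zx.
by rewrite addrCA subrr addr0 addrA addrC.
Qed.

End Cells.

(** * Coverings and Hausdorff measure *)

Section Coverings.
Context {R : realType}.
Implicit Types (x y z w : R * R) (A : set (R * R)).

Lemma diameter_ge0 A : (0 <= diameter A)%E.
Proof. by apply: ereal_sup_ubound; left. Qed.

Lemma diameter_le A (c : R) : 0 <= c ->
  (forall x y, A x -> A y -> eucl_dist x y <= c) -> (diameter A <= c%:E)%E.
Proof.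
move=> c0 h; apply: ge_ereal_sup => _ [->|[[x y] [/= Ax Ay] <-]]; rewrite lee_fin//.
exact: h.
Qed.

Lemma hausdorff1_ge0 A : (0 <= hausdorff1 A)%E.
Proof.
apply: (@le_trans _ _ (hausdorff1_delta 1 A)).
  apply: le_ereal_inf_tmp => _ [U _ <-]; apply: nneseries_ge0 => *.
  exact: diameter_ge0.
by apply: ereal_sup_ubound; exists 1 => //=.
Qed.

Lemma hausdorff1_delta_le (I : finType) (U : I -> set (R * R)) A (delta c : R) :
  0 <= c -> c <= delta -> A `<=` \bigcup_i U i ->
  (forall i, (diameter (U i) <= c%:E)%E) ->
  (hausdorff1_delta delta A <= (#|I|%:R * c)%:E)%E.
Proof.
move=> c0 cd AU Uc.
(* The finite covering is padded with empty sets, whose diameter is 0. *)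
pose V n := oapp (U \o enum_val) set0 (insub n : option 'I_#|I|).
have V0 n : (#|I| <= n)%N -> diameter (V n) = 0%E.
  move=> In; rewrite /V insubF; last by rewrite ltnNge In.
  by apply/le_anti; rewrite diameter_ge0 andbT diameter_le// => x y [].
have Vc n : (diameter (V n) <= c%:E)%E.
  rewrite /V; case: insubP => [i _ _|_]; first exact: Uc.
  by rewrite diameter_le// => x y [].
apply: (@le_trans _ _ (\sum_(0 <= i <oo) diameter (V i))%E).
  apply: ereal_inf_lbound; exists V => //; split=> [x /AU [i _ Ux]|i].
    by exists (enum_rank i) => //; rewrite /V valK /= enum_rankK.
  by rewrite (le_trans (Vc i))// lee_fin.
apply: lime_le; first by apply: is_cvg_nneseries => *; exact: diameter_ge0.
apply: nearW => n; apply: (@le_trans _ _ (\sum_(0 <= i < n | (i < #|I|)%N) c%:E)%E).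
  rewrite [leRHS]big_mkcond /=; apply: lee_sum => i _.
  by case: ltnP => // /V0 ->.
rewrite sumEFin lee_fin big_mkcond /= big_mkord.
apply: (@le_trans _ _ (\sum_(i < maxn n #|I|) (if (i < #|I|)%N then c else 0))).
  rewrite (big_ord_widen_cond _ xpredT (fun i => if (i < #|I|)%N then c else 0)
    (leq_maxl n #|I|)).
  by rewrite big_mkcond /=; apply: ler_sum => i _; case: ifP => //; case: ifP.
rewrite -big_mkcond /= -(big_ord_widen_cond _ xpredT (fun=> c) (leq_maxr n #|I|)).
by rewrite sumr_const card_ord mulr_natl.
Qed.

End Coverings.

(** * The boundary of a cell as four Lipschitz graphs *)

Section Graphs.
Context {R : realType}.
Implicit Types (x y z w : R * R) (A : set (R * R)).

Definition axis_coord (s : bool) z : R := if s then z.2 else z.1.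

(** The sector with half-opening 45 degrees about one of the four coordinate
    half-axes: [s.1] tells the axis by which its graphs are parametrized, which is
    the one orthogonal to the half-axis, and [s.2] is the sign of the half-axis. *)
Definition in_sector (s : bool * bool) (u : R * R) :=
  `|axis_coord s.1 u| <= (-1) ^+ s.2 * axis_coord (~~ s.1) u.

Lemma in_sectorP u : exists s, in_sector s u.
Proof.
have [h|h] := leP `|u.1| `|u.2|.
  have [u0|u0] := leP 0 u.2.
    by exists (false, false); rewrite /in_sector /= expr0 mul1r -[leRHS]ger0_norm.
  by exists (false, true); rewrite /in_sector /= expr1 mulN1r -[leRHS]ltr0_norm.
have [u0|u0] := leP 0 u.1.
  by exists (true, false); rewrite /in_sector /= expr0 mul1r -[leRHS]ger0_norm// ltW.
by exists (true, true); rewrite /in_sector /= expr1 mulN1r -[leRHS]ltr0_norm// ltW.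
Qed.

(** With [(p, q)] and [(p', q')] outer normals of a convex set at two points that
    differ by [(a, b)]: normals within 45 degrees of the second axis force the
    difference to be within 45 degrees of the first. *)
Lemma slope_le (a b p q p' q' : R) : `|p| <= q -> `|p'| <= q' -> 0 < q -> 0 < q' ->
  a * p + b * q <= 0 -> 0 <= a * p' + b * q' -> `|b| <= `|a|.
Proof.
move=> pq pq' q0 q0' h h'; rewrite ler_norml lerNl; apply/andP; split.
  rewrite -(ler_pM2r q0'); apply: (@le_trans _ _ (a * p')); first lra.
  by apply: (le_trans (ler_norm _)); rewrite normrM ler_wpM2l.
rewrite -(ler_pM2r q0); apply: (@le_trans _ _ (- (a * p))); first lra.
by apply: (le_trans (ler_norm _)); rewrite normrN normrM ler_wpM2l.
Qed.

Lemma in_sector_gt0 s u : u != 0 -> in_sector s u ->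
  0 < (-1) ^+ s.2 * axis_coord (~~ s.1) u.
Proof.
rewrite /in_sector => u0 su; have := le_trans (normr_ge0 _) su.
rewrite le_eqVlt => /orP[/eqP e|//]; exfalso; move/eqP: u0; apply.
move: su; rewrite -e normr_le0 => /eqP su; move: e => /esym/eqP.
rewrite mulf_eq0 signr_eq0 /= => /eqP e.
by case: u su e => u1 u2; rewrite /axis_coord; case: s.1 => /= -> ->.
Qed.

Definition dotp (u v : R * R) : R := u.1 * v.1 + u.2 * v.2.

Lemma dotp_sector (s : bool * bool) u v :
  dotp u v = axis_coord s.1 u * axis_coord s.1 v +
    ((-1) ^+ s.2 * axis_coord (~~ s.1) u) * ((-1) ^+ s.2 * axis_coord (~~ s.1) v).
Proof.
rewrite mulrACA -expr2 sqrr_sign mul1r /dotp /axis_coord.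
by case: s.1 => //=; rewrite addrC.
Qed.

(** This makes the boundary points of a cell with normals in one sector a
    1-Lipschitz graph: [d] is the difference of two of them, [u] and [v] are
    their normals. *)
Lemma sector_lipschitz s (u v d : R * R) : u != 0 -> v != 0 ->
  in_sector s u -> in_sector s v -> dotp d u <= 0 -> 0 <= dotp d v ->
  `|axis_coord (~~ s.1) d| <= `|axis_coord s.1 d|.
Proof.
move=> u0 v0 su sv; rewrite (dotp_sector s d u) (dotp_sector s d v) => hu hv.
have := slope_le su sv (in_sector_gt0 u0 su) (in_sector_gt0 v0 sv) hu hv.
by rewrite normrM normr_sign mul1r.
Qed.

(** So [y - x] is an outer normal at [z] to the cell of [x]. *)
Lemma bisector_dotp x y z w : sqnorm (z - x) = sqnorm (z - y) ->
  sqnorm (w - x) <= sqnorm (w - y) -> dotp (w - z) (y - x) <= 0.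
Proof.
by case: x y z w => [x1 x2] [y1 y2] [z1 z2] [w1 w2]; rewrite /sqnorm /dotp /=; lra.
Qed.

(** The part of the boundary of the cell of [x] with a normal in the sector [s],
    over the [i]-th of the [m + 1] equal intervals that divide [[-1, 1]]. *)
Definition cell_boundary_piece A (m : nat) x (s : bool * bool) (i : nat) : set (R * R) :=
  [set z | [/\ voronoi_cell A x z,
    i%:R <= (axis_coord s.1 z + 1) / 2 * m.+1%:R <= i.+1%:R &
    exists y, [/\ A y, y <> x, sqnorm (z - x) = sqnorm (z - y) &
      in_sector s (y - x)]]].

Lemma diameter_cell_boundary_piece A m x s i : A x ->
  (diameter (cell_boundary_piece A m x s i) <= (4 / m.+1%:R)%:E)%E.
Proof.
move=> Ax; apply: diameter_le => [|z w]; first by rewrite divr_ge0.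
move=> [Cz iz [y [Ay yx zy sy]]] [Cw iw [u [Au ux wu su]]].
have m0 : (0 : R) < m.+1%:R by rewrite ltr0n.
set c := 4 / _.
have cm : c * m.+1%:R = 4 by rewrite /c divfK// gt_eqF.
have c0 : 0 < c by rewrite /c divr_gt0// ltr0n.
have hc : `|axis_coord s.1 (z - w)| <= c / 2.
  have -> : axis_coord s.1 (z - w) = axis_coord s.1 z - axis_coord s.1 w.
    by rewrite /axis_coord; case: s.1.
  move: iz iw; rewrite -[i.+1%:R]natr1 => /andP[z1 z2] /andP[w1 w2].
  rewrite ler_norml; apply/andP; split; rewrite -(ler_pM2r m0);
    move: z1 z2 w1 w2 cm; clear; lra.
have hd : `|axis_coord (~~ s.1) (z - w)| <= `|axis_coord s.1 (z - w)|.
  apply: (@sector_lipschitz s (u - x) (y - x)) => //.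
  - by rewrite subr_eq0; apply/eqP.
  - by rewrite subr_eq0; apply/eqP.
  - exact: bisector_dotp wu ((voronoi_cellP z Ax).1 Cz u Au).
  - rewrite -[leRHS]opprK -[0]oppr0 lerN2.
    have := bisector_dotp zy ((voronoi_cellP w Ax).1 Cw y Ay).
    by rewrite /dotp /=; lra.
have hs : sqnorm (z - w) =
    axis_coord s.1 (z - w) ^+ 2 + axis_coord (~~ s.1) (z - w) ^+ 2.
  by rewrite /sqnorm /axis_coord; case: s.1 => //=; rewrite addrC.
rewrite eucl_distE hs -[leRHS](ger0_norm (ltW c0)) -sqrtr_sqr; apply: ler_wsqrtr.
rewrite -[X in X + _](real_normK (num_real _)) -[X in _ + X](real_normK (num_real _)).
have h1 : `|axis_coord s.1 (z - w)| ^+ 2 <= (c / 2) ^+ 2.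
  by rewrite ler_sqr ?nnegrE ?normr_ge0// divr_ge0// ltW.
have h2 : `|axis_coord (~~ s.1) (z - w)| ^+ 2 <=
    `|axis_coord s.1 (z - w)| ^+ 2.
  by rewrite ler_sqr ?nnegrE ?normr_ge0.
apply: le_trans (lerD h1 (le_trans h2 h1)) _; have := sqr_ge0 c; clear; lra.
Qed.

Lemma unit_partition (m : nat) (t : R) : 0 <= t <= m.+1%:R ->
  exists i : 'I_m.+1, i%:R <= t <= i.+1%:R.
Proof.
move=> /andP[t0]; elim: m => [|m IH] tm; first by exists ord0; rewrite t0 tm.
have [h|h] := leP t m.+1%:R.
  by have [i hi] := IH h; exists (widen_ord (leqnSn _) i).
by exists ord_max; rewrite /= (ltW h) tm.
Qed.

Lemma boundary_voronoi_cell_pieces A m x : locally_finite A -> A x ->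
  boundary (voronoi_cell A x) `&` disk (0, 0) 1 `<=`
  \bigcup_(k : (bool * bool) * 'I_m.+1) cell_boundary_piece A m x k.1 k.2.
Proof.
move=> lfA Ax z [bz]; rewrite /disk /= eucl_distE -(ler_sqr) ?nnegrE ?sqrtr_ge0//.
rewrite sqr_sqrtr ?sqnorm_ge0// expr1n => z1.
have [Cz [y [Ay yx zy]]] := boundary_voronoi_cell lfA Ax bz.
have [s hs] := in_sectorP (y - x).
have [i hi] : exists i : 'I_m.+1,
    i%:R <= (axis_coord s.1 z + 1) / 2 * m.+1%:R <= i.+1%:R.
  apply: unit_partition; have m0 : (0 : R) < m.+1%:R by rewrite ltr0n.
  have : -1 <= axis_coord s.1 z <= 1.
    rewrite -ler_norml -ler_sqr ?nnegrE// real_normK ?num_real// expr1n.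
    apply: le_trans z1; rewrite /sqnorm /= !sub0r !sqrrN /axis_coord.
    by case: s.1; rewrite ?lerDl ?lerDr sqr_ge0.
  move=> /andP[l u]; rewrite mulr_ge0//=; last by lra.
  by rewrite ler_piMl//; lra.
by exists (s, i) => //; split => //; exists y.
Qed.

(** The four sectors and [m + 1] intervals cover the boundary of a cell by
    [4 (m + 1)] pieces of diameter at most [4 / (m + 1)], whence the constant 16;
    [F] is any finite set of nuclei containing those whose cells meet the unit
    disk. *)
Lemma hausdorff1_voronoi_le A F : locally_finite A ->
  finite_set F -> F `<=` A ->
  (forall x z, A x -> voronoi_cell A x z -> sqnorm z <= 1 -> F x) ->
  (hausdorff1 (voronoi A `&` disk (0, 0)%R 1%R) <= (16 * #|` fset_set F|%:R)%:E)%E.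
Proof.
move=> lfA finF FA hF; apply: ge_ereal_sup => _ [delta delta0 <-].
have [m hm] : exists m, 4 / m.+1%:R <= delta.
  exists (Num.bound (4 / delta)).
  have := archi_boundP (ltW (divr_gt0 (ltr0Sn R 3) delta0)).
  move: (Num.bound _) => b; rewrite ltr_pdivrMr// => hb.
  rewrite ler_pdivrMr ?ltr0Sn// -[b.+1%:R]natr1 mulrDr mulr1 mulrC.
  by apply/ltW; rewrite (lt_le_trans hb)// lerDl ltW.
have c0 : (0:R) <= 4 / m.+1%:R by rewrite divr_ge0.
apply: le_trans (@hausdorff1_delta_le R
  ({: fset_set F} * ((bool * bool) * 'I_m.+1))%type
  (fun k => cell_boundary_piece A m (val k.1) k.2.1 k.2.2) _ _ _ c0 hm _ _) _.
- move=> z [[x Ax bz] dz].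
  have [k _ hk] := boundary_voronoi_cell_pieces m lfA Ax (conj bz dz).
  have Fx : x \in fset_set F.
    rewrite in_fset_set//; apply/mem_set; apply: (hF x z) => //; first by case: hk.
    move: dz; rewrite /disk /= eucl_distE -(ler_sqr) ?nnegrE ?sqrtr_ge0//.
    by rewrite sqr_sqrtr ?sqnorm_ge0// expr1n /sqnorm /= !sub0r !sqrrN.
  by exists ([` Fx]%fset, k).
- move=> k; apply: diameter_cell_boundary_piece; apply: FA.
  by have := valP k.1; rewrite in_fset_set// => /set_mem.
- rewrite lee_fin !card_prod card_bool card_ord cardfE !natrM.
  rewrite le_eqVlt; apply/orP; left; apply/eqP.
  have : m.+1%:R != 0 :> R by rewrite pnatr_eq0.
  by move: m.+1%:R => M M0; field.
Qed.
End Graphs.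

(** * Areas of disks and annuli *)

Section Areas.
Context {R : realType}.
Implicit Types (x y z w : R * R).

Definition odisk (rho : R) : set (R * R) := [set x | sqnorm x < rho ^+ 2].

Lemma measurable_odisk rho : measurable (odisk rho).
Proof.
have ms : measurable_fun setT (@sqnorm R).
  apply: measurable_funD; apply: measurable_funX; first exact: measurable_fst.
  exact: measurable_snd.
rewrite (_ : odisk rho = setT `&` sqnorm @^-1` [set` `]-oo, rho ^+ 2[%R]); last first.
  by rewrite setTI; apply/seteqP; split=> x /=; rewrite /odisk /= in_itv.
exact: ms.
Qed.

Lemma odisk_square rho x : 0 <= rho -> odisk rho x -> `|x.1| < rho /\ `|x.2| < rho.
Proof.
rewrite /odisk /sqnorm /= => r0 h.
by split; rewrite -ltr_sqr ?nnegrE// real_normK ?num_real//; apply: le_lt_trans h;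
  rewrite ?lerDl ?lerDr sqr_ge0.
Qed.

Lemma bounded_odisk rho : 0 <= rho -> bounded_set (odisk rho).
Proof.
move=> r0; exists rho; split; first exact: num_real.
move=> M rM x /(odisk_square r0)[x1 x2] /=; rewrite prod_normE /= ge_max.
by rewrite !(le_trans (ltW _) (ltW rM)).
Qed.

Lemma area_ge0 (A : set (R * R)) : (0 <= area A)%E.
Proof. exact: measure_ge0. Qed.

Lemma area_set0 : area (set0 : set (R * R)) = 0%E.
Proof. exact: measure0. Qed.

Lemma area_setU_le (A B : set (R * R)) : measurable A -> measurable B ->
  (area (A `|` B) <= area A + area B)%E.
Proof. by move=> mA mB; exact: measureU2. Qed.

Lemma area_fin_num (A : set (R * R)) : (area A < +oo)%E -> area A \is a fin_num.
Proof. by move=> Aoo; rewrite ge0_fin_numE// area_ge0. Qed.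

Lemma fine_area_ge0 (A : set (R * R)) : 0 <= fine (area A).
Proof. by apply: fine_ge0; exact: area_ge0. Qed.

Lemma area_rect (a b c d : R) : a <= b -> c <= d ->
  area (`[a, b]%classic `*` `[c, d]%classic) = ((b - a) * (d - c))%:E.
Proof.
move=> ab cd; rewrite /area product_measure1E//=.
rewrite !lebesgue_measure_itv /= !lte_fin.
move: ab cd; rewrite !le_eqVlt => /orP[/eqP->|->] /orP[/eqP->|->];
  by rewrite ?ltxx -?EFinB -?EFinM ?subrr ?mul0r ?mulr0 ?mule0 ?mul0e.
Qed.

Lemma area_odisk_ge rho : 0 <= rho -> ((rho ^+ 2)%:E <= area (odisk rho))%E.
Proof.
rewrite le_eqVlt => /orP[/eqP<-|r0]; first by rewrite expr0n /= area_ge0.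
have -> : rho ^+ 2 = (rho / 2 - (- (rho / 2))) * (rho / 2 - (- (rho / 2))).
  by field.
rewrite -area_rect; [|lra..].
apply: area_mono => -[a b] [/=]; rewrite !in_itv /= => ha hb; rewrite /odisk /sqnorm /=.
nra.
Qed.

Lemma area_odisk_le rho : 0 <= rho -> (area (odisk rho) <= (4 * rho ^+ 2)%:E)%E.
Proof.
move=> r0; rewrite (_ : 4 * _ = (rho - (- rho)) * (rho - (- rho))); last by ring.
rewrite -area_rect; [|lra..].
apply: area_mono => x /(odisk_square r0)[x1 x2] /=.
by rewrite !in_itv /= -!ler_norml !ltW.
Qed.

(** Each vertical section of the annulus consists of at most two intervals of
    length at most [s], by subadditivity of the square root; for
    [rho = n] and [sigma = n + 3] the bound is [O(n^(3/2))]. *)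
Lemma area_annulus_le (rho sigma s : R) : 0 <= sigma -> 0 <= s ->
  sigma ^+ 2 - rho ^+ 2 <= s ^+ 2 ->
  (area (odisk sigma `\` odisk rho) <= (4 * sigma * s)%:E)%E.
Proof.
move=> g0 s0 hs.
apply: (@le_trans _ _ (\int[lebesgue_measure]_x
   ((2 * s)%:E * (\1_(`[- sigma, sigma]%classic : set R) x)%:E)))%E; last first.
  rewrite ge0_integralZl ?lee_fin ?mulr_ge0//; last first.
    exact: measurableT_comp.
  rewrite integral_indic// setIT /= lebesgue_measure_itv /= lte_fin.
  case: ifPn => h.
    by rewrite -EFinB -EFinM lee_fin; nra.
  by rewrite mule0 lee_fin !mulr_ge0.
apply: ge0_le_integral_nonmeas => x _ /=; first exact: measure_ge0.
have [h|h] := leP `|x| sigma; last first.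
  rewrite (_ : xsection _ _ = set0) ?measure0 ?mule_ge0 ?lee_fin ?mulr_ge0//.
  apply/seteqP; split=> // y; rewrite /xsection /= inE => -[/odisk_square h1 _].
  by have [/= + _] := h1 g0; rewrite ltNge (ltW h).
rewrite indicE mem_set /=; last by rewrite in_itv /= -ler_norml.
rewrite mule1; set a := Num.sqrt (rho ^+ 2 - x ^+ 2).
have a0 : 0 <= a by exact: sqrtr_ge0.
have sub : xsection (odisk sigma `\` odisk rho) x `<=`
  `[a, a + s]%classic `|` `[- (a + s), - a]%classic.
  move=> y; rewrite /xsection /= inE /odisk /sqnorm /= => -[h1 /negP].
  rewrite -leNgt => h2.
  have ay : a <= `|y| by rewrite -[leRHS]sqrtr_sqr /a; apply: ler_wsqrtr; lra.
  have a2 : rho ^+ 2 - x ^+ 2 <= a ^+ 2.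
    have [c0|c0] := leP 0 (rho ^+ 2 - x ^+ 2); first by rewrite sqr_sqrtr.
    by rewrite (le_trans (ltW c0))// sqr_ge0.
  have ys : `|y| <= a + s.
    rewrite -ler_sqr ?nnegrE ?addr_ge0// real_normK ?num_real//; nra.
  rewrite !in_itv /=; have [y0|y0] := leP 0 y.
    by left; rewrite -(ger0_norm y0) ay.
  by right; move: ay ys; rewrite ltr0_norm//; lra.
apply: le_trans (lebesgue_measure_mono sub) _.
apply: le_trans (measureU2 _ _ _) _ => //.
rewrite /= !lebesgue_measure_itv /= !lte_fin; case: ifPn => _; case: ifPn => _;
  rewrite -?EFinB -?EFinD ?adde0 ?add0e lee_fin; lra.
Qed.
End Areas.

(** * Series, and lower bounds for integrals *)

Section Series.
Context {R : realType}.
Local Open Scope ereal_scope.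

Lemma nneseries_term_le (u : nat -> \bar R) k :
  (forall n, 0 <= u n) -> u k <= \sum_(0 <= n <oo) u n.
Proof.
move=> u0; apply: le_trans (nneseries_lim_ge k.+1 _) => //=.
by rewrite big_nat_recr //= leeDr// sume_ge0.
Qed.

Lemma expR_eseries (y : R) : (0 <= y)%R ->
  \sum_(0 <= k <oo) (y ^+ k / k`!%:R)%:E = (expR y)%:E.
Proof.
move=> y0; rewrite expRE -EFin_lim; last first.
  rewrite /pseries/=; under eq_fun do rewrite mulrC.
  exact: is_cvg_series_exp_coeff.
apply/congr_lim/funext => n/=; rewrite /pseries/= /series/= -sumEFin//.
by under [RHS]eq_bigr do rewrite mulrC.
Qed.

Lemma poisson_exp_moment (m c : R) : (0 <= m)%R ->
  \sum_(0 <= k <oo) (expR (c * k%:R) * poisson_weight m k)%:E =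
  (expR (m * (expR c - 1)))%:E.
Proof.
move=> m0; pose y := (m * expR c)%R.
have y0 : (0 <= y)%R by rewrite mulr_ge0// expR_ge0.
have E k : (expR (c * k%:R) * poisson_weight m k)%:E
    = (expR (- m))%:E * (y ^+ k / k`!%:R)%:E.
  rewrite -EFinM expRM_natr /poisson_weight /y exprMn; congr EFin; ring.
under eq_eseriesr do rewrite E.
rewrite nneseriesZl; last by move=> k _; rewrite lee_fin divr_ge0// exprn_ge0.
by rewrite expR_eseries// -EFinM -expRD /y; congr (expR _)%:E; ring.
Qed.

(** At each point at most one of the indicators of the disjoint events is nonzero,
    so the series of the weighted indicators, which is measurable, lies below
    [f]. *)
Lemma nneseries_le_integral d (T : measurableType d) (mu : {measure set T -> \bar R})
    (F : nat -> set T) (c : nat -> R) (f : T -> \bar R) :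
  (forall k, measurable (F k)) -> trivIset setT F -> (forall k, 0 <= c k)%R ->
  (forall x, 0 <= f x) -> (forall k x, F k x -> (c k)%:E <= f x) ->
  \sum_(0 <= k <oo) (c k)%:E * mu (F k) <= \int[mu]_x f x.
Proof.
move=> mF tF c0 f0 cf.
have m1 k : measurable_fun setT (fun x => (\1_(F k) x)%:E : \bar R).
  by apply/measurable_EFinP; exact: measurable_indic.
have -> : \sum_(0 <= k <oo) (c k)%:E * mu (F k) =
    \int[mu]_x \sum_(0 <= k <oo) (c k)%:E * (\1_(F k) x)%:E.
  rewrite integral_nneseries//.
  - apply: eq_eseriesr => k _.
    transitivity ((c k)%:E * \int[mu]_x (\1_(F k) x)%:E).
      by rewrite integral_indic// setIT.
    by apply/esym/ge0_integralZl => //; rewrite lee_fin.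
  - by move=> k; exact: measurable_funeM.
  - by move=> k x _; rewrite mule_ge0 ?lee_fin.
have t0 x k : 0 <= (c k)%:E * (\1_(F k) x)%:E by rewrite mule_ge0 ?lee_fin.
apply: ge0_le_integral_nonmeas => x _; first by apply: nneseries_ge0.
have [[k Fkx]|nF] := pselect (exists k, F k x); last first.
  rewrite (_ : \sum_(0 <= k <oo) _ = 0)// eseries0// => k _ _.
  by rewrite indicE memNset ?mule0// => Fkx; apply: nF; exists k.
apply: lime_le; first by apply: is_cvg_nneseries => *; exact: t0.
apply: nearW => n; apply: (le_trans _ (cf _ _ Fkx)).
have E i : (c i)%:E * (\1_(F i) x)%:E = if (i == k)%N then (c i)%:E else 0.
  rewrite indicE; case: eqVneq => [->|ik]; first by rewrite mem_set// mule1.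
  rewrite memNset ?mule0// => Fix_; move/eqP: ik; apply.
  by apply: tF => //; exists x.
under eq_bigr do rewrite E.
by rewrite -big_mkcond big_nat1_eq; case: ifP => _; rewrite lee_fin.
Qed.
End Series.

(** * Counting points, and the energy of finitely many points *)

Section Energy.
Context {R : realType}.
Local Open Scope ereal_scope.
Implicit Types (w xi om : config R) (B D : set (R * R)).

Lemma count_in_eq0 B w : count_in B w = 0 -> points w `&` B = set0.
Proof.
rewrite /count_in /counting; case: asboolP => // fin [] /eqP.
by rewrite pnatr_eq0 => /eqP/cardfs0_eq; exact: fset_set_set0.
Qed.

Lemma count_in0 B w : points w `&` B = set0 -> count_in B w = 0.
Proof.
move=> e; rewrite /count_in e /counting; case: asboolP => [_|[]]; last exact: finite_set0.
by rewrite fset_set0 cardfs0.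
Qed.

Lemma bounded_set_sub B D : B `<=` D -> bounded_set D -> bounded_set B.
Proof.
by move=> BD [M [Mr hM]]; exists M; split=> // N MN x /BD; exact: hM.
Qed.

Lemma measurable_count_event B n : measurable B -> bounded_set B ->
  measurable (count_event B n : set (config R)).
Proof. by move=> mB bB; apply: sub_sigma_algebra; exists B, n. Qed.

(** The generators of the sigma-algebra count points in bounded sets only; the
    emptiness of an unbounded set is the emptiness of its bounded parts. *)
Lemma measurable_no_point B : measurable B ->
  measurable (count_event B 0 : set (config R)).
Proof.
move=> mB; rewrite (_ : count_event B 0 =
    \bigcap_(k : nat) count_event (B `&` odisk k%:R) 0).
  apply: bigcapT_measurable => k; apply: measurable_count_event.
    by apply: measurableI => //; exact: measurable_odisk.
  by apply: bounded_set_sub (bounded_odisk (ler0n _ k)) => x [].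
apply/seteqP; split=> w.
  move=> /count_in_eq0 e k _; apply: count_in0.
  by rewrite setIA e set0I.
move=> h; apply: count_in0; apply/seteqP; split=> // x [wx Bx].
pose k := Num.bound (sqnorm x + 1).
have xk : odisk k%:R x.
  have := archi_boundP (addr_ge0 (sqnorm_ge0 x) ler01); rewrite -/k /odisk /=.
  have := sqnorm_ge0 x; nra.
by have /count_in_eq0/seteqP[/(_ x) + _] := h k I; apply.
Qed.

Lemma area_bigcup_le (s : seq (R * R)) (U : R * R -> set (R * R)) (c : R) :
  (forall x, measurable (U x)) -> (forall x, area (U x) = c%:E) ->
  area (\bigcup_(x in [set` s]) U x) <= ((size s)%:R * c)%:E.
Proof.
move=> mU aU; elim: s => [|x s IH].
  by rewrite set_nil bigcup_set0 mul0r area_set0.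
rewrite (_ : \bigcup_(_ in _) _ = U x `|` \bigcup_(x in [set` s]) U x); last first.
  apply/seteqP; split=> z.
    by move=> [y /=]; rewrite in_cons => /orP[/eqP->|ys] Uz; [left|right; exists y].
  move=> [Uz|[y ys Uz]]; first by exists x; rewrite //= mem_head.
  by exists y; rewrite //= in_cons ys orbT.
apply: le_trans (area_setU_le _ _) _ => //.
  by apply: fin_bigcup_measurable => //; exact: finite_seq.
by rewrite /= -natr1 mulrDl mul1r EFinD addeC leeD// aU.
Qed.

Lemma wr_energy_ge0 (r : R) xi om : 0 <= wr_energy r xi om.
Proof. exact: area_ge0. Qed.

(** Each disk lies in a square of side [2 r]. *)
Lemma wr_energy_le (r : R) xi om : (0 < r)%R -> finite_set (points xi) ->
  wr_energy r xi om <= (#|` fset_set (points xi)|%:R * (4 * r ^+ 2))%:E.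
Proof.
move=> r0 fin.
pose U (x : R * R) := `[(x.1 - r)%R, (x.1 + r)%R]%classic `*`
  `[(x.2 - r)%R, (x.2 + r)%R]%classic.
apply: le_trans (@area_bigcup_le (fset_set (points xi)) U (4 * r ^+ 2)%R _ _).
- apply: area_mono => z [[x xix zx] _]; exists x.
    by rewrite /= in_fset_set//; exact/mem_set.
  move: zx; rewrite /disk /= eucl_distE -ler_sqr ?nnegrE ?sqrtr_ge0 ?(ltW r0)//.
  rewrite sqr_sqrtr ?sqnorm_ge0// /sqnorm /U /= !in_itv /= => zx.
  have h (a b : R) : ((a - b) ^+ 2 <= r ^+ 2)%R -> (a - r <= b <= a + r)%R.
    rewrite -[X in (X <= _)%R]real_normK ?num_real// ler_sqr ?nnegrE ?(ltW r0)//.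
    rewrite ler_norml.
    by move=> /andP[? ?]; apply/andP; split; lra.
  by split; apply: h; apply: le_trans zx; rewrite ?lerDl ?lerDr sqr_ge0.
- by move=> x; apply: measurableX.
- move=> x; rewrite area_rect; [|lra..].
  by congr EFin; ring.
Qed.

Lemma boltzmann_bounds (r gamma g : R) xi om k : (0 < r)%R ->
  (`|gamma| * (4 * r ^+ 2) <= g)%R ->
  finite_set (points xi) -> #|` fset_set (points xi)| = k ->
  (expR (- g * k%:R))%:E <= boltzmann gamma (wr_energy r) om xi <= (expR (g * k%:R))%:E.
Proof.
move=> r0 gg fin <-; have := wr_energy_le om r0 fin; have := wr_energy_ge0 r xi om.
rewrite /boltzmann; case: (wr_energy r xi om) => [e||] //=.
rewrite !lee_fin !ler_expR => e0 ek.
have : (`|gamma * e| <= g * (#|` fset_set (points xi)|)%:R)%R.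
  rewrite normrM (ger0_norm e0); apply: le_trans (ler_wpM2r (ler0n _ _) gg).
  by rewrite -mulrA ler_wpM2l// mulrC.
by rewrite ler_norml mulNr => /andP[? ?]; apply/andP; split; lra.
Qed.
End Energy.

(** * The Gibbs kernel compared with the Poisson process *)

Section Poisson.
Context {R : realType}.
Local Open Scope ereal_scope.
Implicit Types (w xi om : config R) (A B D : set (R * R)).

Lemma count_inP A w k : count_in A w = k%:R%:E ->
  finite_set (points w `&` A) /\ #|` fset_set (points w `&` A)| = k.
Proof.
rewrite /count_in /counting; case: asboolP => // fin [] /eqP.
by rewrite eqr_nat => /eqP.
Qed.

Lemma count_in_card A w : finite_set (points w `&` A) ->
  count_in A w = (#|` fset_set (points w `&` A)|)%:R%:E.
Proof. by move=> fin; rewrite /count_in /counting; case: asboolP. Qed.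

Lemma no_point_setC B w : count_in (~` B) w = 0 -> points w `&` B = points w.
Proof.
move=> /count_in_eq0/seteqP[h _]; apply/seteqP; split=> [x []//|x wx]; split=> //.
by apply: contrapT => nBx; apply: (h x).
Qed.

Section Law.
Variables (lambda : R) (B : set (R * R)) (Pi : probability (config R) R).
Hypothesis law : poisson_process_law lambda B Pi.

Lemma poisson_count A n : measurable A -> A `<=` B ->
  Pi (count_event A n) = (poisson_weight (lambda * fine (area A)) n)%:E.
Proof. by move=> mA AB; have := law.1 A n mA; rewrite (setIidl AB). Qed.

Lemma poisson_no_point_outside : measurable B -> Pi (count_event (~` B) 0) = 1.
Proof.
move=> mB; rewrite law.1 ?setICl; last exact: measurableC.
by rewrite area_set0 /= mulr0 /poisson_weight expr0 fact0 divr1 oppr0 expR0 mulr1.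
Qed.

Lemma poisson_indep2 A1 A2 n1 n2 : measurable A1 -> measurable A2 ->
  A1 `&` A2 = set0 ->
  Pi (count_event A1 n1 `&` count_event A2 n2) =
  Pi (count_event A1 n1) * Pi (count_event A2 n2).
Proof.
move=> m1 m2 A12.
have := law.2 2%N (fun i => if i == ord0 then A1 else A2)
  (fun i => if i == ord0 then n1 else n2).
rewrite !big_ord_recl big_ord0 /= mule1 => <-.
- congr (Pi _); apply/seteqP; split=> w.
    by move=> [w1 w2] i _; case: ifP.
  by move=> h; split; [have := h ord0 I|have := h (lift ord0 ord0) I].
- by move=> i; case: ifP.
- apply/trivIsetP => -[[|[|//]] hi] -[[|[|//]] hj] _ _; rewrite -!val_eqE //= => _.
  by rewrite setIC.
Qed.

(** On the event of [k] points in [B] and none outside, the weight is at least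
    [exp (- g k)]; summing over [k] gives the exponential moment of order [- g] of
    the Poisson number of points in [B]. *)
Lemma boltzmann_integral_ge (r gamma g : R) om : (0 <= lambda)%R ->
  measurable B -> bounded_set B -> (0 < r)%R -> (`|gamma| * (4 * r ^+ 2) <= g)%R ->
  (expR (lambda * fine (area B) * (expR (- g) - 1)))%:E <=
  \int[Pi]_xi boltzmann gamma (wr_energy r) om xi.
Proof.
move=> l0 mB bB r0 hg.
have mBc : measurable (~` B) by exact: measurableC.
rewrite -poisson_exp_moment; last by rewrite mulr_ge0// fine_area_ge0.
pose F k := count_event B k `&` count_event (~` B) 0 : set (config R).
have FE k : Pi (F k) = (poisson_weight (lambda * fine (area B)) k)%:E.
  rewrite /F poisson_indep2 ?setICr// poisson_no_point_outside// mule1.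
  exact: poisson_count.
under eq_eseriesr do rewrite EFinM -FE.
apply: nneseries_le_integral.
- move=> k; apply: measurableI; first exact: measurable_count_event.
  exact: measurable_no_point.
- move=> i j _ _ [w [[wi _] [wj _]]].
  by move: wi; rewrite /count_event /= wj => -[] /eqP; rewrite eqr_nat => /eqP.
- by move=> k; rewrite expR_ge0.
- by move=> xi; exact: expeR_ge0.
- move=> k xi [/count_inP + /no_point_setC] => /[swap] -> [fin card].
  by have /andP[] := boltzmann_bounds om r0 hg fin card.
Qed.

(** For configurations without points in [D] the energy is at most proportional to
    the number [k] of points in [A]. *)
Lemma boltzmann_integral_le D A (r gamma g : R) om k :
  measurable D -> measurable A -> bounded_set B -> D `&` A = set0 -> D `|` A = B ->
  (0 < r)%R -> (`|gamma| * (4 * r ^+ 2) <= g)%R ->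
  \int[Pi]_(xi in count_event D 0 `&` count_event A k `&` count_event (~` B) 0)
    boltzmann gamma (wr_energy r) om xi <=
  (expR (g * k%:R) * (expR (- (lambda * fine (area D))) *
    poisson_weight (lambda * fine (area A)) k))%:E.
Proof.
move=> mD mA bB DA DAB r0 hg.
have mB : measurable B by rewrite -DAB; exact: measurableU.
have DB : D `<=` B by rewrite -DAB; exact: subsetUl.
have AB : A `<=` B by rewrite -DAB; exact: subsetUr.
set E := _ `&` _.
have mDA : measurable (count_event D 0 `&` count_event A k : set (config R)).
  apply: measurableI; apply: measurable_count_event => //; exact: bounded_set_sub bB.
have mE : measurable E.
  apply: measurableI => //; apply: measurable_no_point; exact: measurableC.
apply: (@le_trans _ _ (\int[Pi]_(xi in E) (cst (expR (g * k%:R))%:E xi))).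
  apply: ge0_le_integral_nonmeas => xi; first by move=> _; exact: expeR_ge0.
  move=> [[/count_in_eq0 xD /count_inP[fin card]] /no_point_setC xB].
  have xA : points xi `&` A = points xi.
    by rewrite -xB -DAB setIUr xD set0U -setIA setIid.
  rewrite xA in fin card.
  by have /andP[] := boltzmann_bounds om r0 hg fin card.
rewrite integral_cst// EFinM lee_pmul2l//; last by rewrite lte_fin expR_gt0.
apply: (@le_trans _ _ (Pi (count_event D 0 `&` count_event A k))).
  by apply: (le_measure Pi _ _ (@subIsetl _ _ _)); apply/mem_set.
rewrite poisson_indep2// !poisson_count// -EFinM lee_fin.
by rewrite {1}/poisson_weight expr0 fact0 divr1 mul1r.
Qed.

Lemma gibbs_kernel_le D A (r gamma g : R) om k : (0 <= lambda)%R ->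
  measurable D -> measurable A -> bounded_set B -> D `&` A = set0 -> D `|` A = B ->
  (0 < r)%R -> (`|gamma| * (4 * r ^+ 2) <= g)%R ->
  gibbs_kernel Pi gamma (wr_energy r) om
    (count_event D 0 `&` count_event A k `&` count_event (~` B) 0) <=
  (expR (g * k%:R) * (expR (- (lambda * fine (area D))) *
    poisson_weight (lambda * fine (area A)) k) *
   expR (lambda * fine (area B) * (1 - expR (- g))))%:E.
Proof.
move=> l0 mD mA bB DA DAB r0 hg.
have mB : measurable B by rewrite -DAB; exact: measurableU.
rewrite /gibbs_kernel EFinM; apply: lee_pmul.
- by apply: integral_ge0 => xi _; exact: expeR_ge0.
- by rewrite inve_ge0; apply: integral_ge0 => xi _; exact: expeR_ge0.
- exact: boltzmann_integral_le.
- rewrite inve_ple ?inE ?lee_fin ?expR_ge0//; last first.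
    by apply: integral_ge0 => xi _; exact: expeR_ge0.
  rewrite inver gt_eqF ?expR_gt0// -expRN -mulrN opprB.
  exact: boltzmann_integral_ge.
Qed.
End Law.
End Poisson.

(** * The number of points of the Gibbs process around an empty disk *)

Section GibbsCounts.
Context {R : realType}.
Local Open Scope ereal_scope.
Implicit Types (w xi om : config R) (A B D : set (R * R)).

Lemma count_in_restrict B D w : D `<=` B ->
  count_in D (restrict_config B w) = count_in D w.
Proof. by move=> DB; rewrite /count_in /= -setIA (setIidr DB). Qed.

Lemma count_in_restrictC B w : count_in (~` B) (restrict_config B w) = 0.
Proof. by apply: count_in0; rewrite /= -setIA setICr setI0. Qed.

Lemma gibbs_count_probability d (T : measurableType d) (P : probability T R)
    (X : T -> config R) (lambda r gamma g : R) D A k : (0 <= lambda)%R -> (0 < r)%R ->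
  gibbs_process P X lambda gamma (wr_energy r) ->
  measurable D -> measurable A -> bounded_set (D `|` A) -> D `&` A = set0 ->
  (`|gamma| * (4 * r ^+ 2) <= g)%R ->
  P [set t | count_in D (X t) = 0 /\ count_in A (X t) = k%:R%:E] <=
  (expR (g * k%:R) * (expR (- (lambda * fine (area D))) *
    poisson_weight (lambda * fine (area A)) k) *
   expR (lambda * fine (area (D `|` A)) * (1 - expR (- g))))%:E.
Proof.
move=> l0 r0 gibbs mD mA bB DA hg; set B := D `|` A in bB *.
have mB : measurable B by exact: measurableU.
have [Pi [law cl]] := gibbs B mB bB.
pose E : set (config R) :=
  count_event D 0 `&` count_event A k `&` count_event (~` B) 0.
have mE : measurable E.
  apply: measurableI; last by apply: measurable_no_point; exact: measurableC.
  by apply: measurableI; apply: measurable_count_event => //;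
    apply: bounded_set_sub bB; [exact: subsetUl|exact: subsetUr].
have [_ /(_ setT measurableT)] := cl E mE.
rewrite preimage_setT setIT => PE.
rewrite (_ : [set t | _] = (fun t => restrict_config B (X t)) @^-1` E); last first.
  have DB : D `<=` B by exact: subsetUl.
  have AB : A `<=` B by exact: subsetUr.
  apply/seteqP; split=> t; rewrite /E /count_event /=;
    rewrite (count_in_restrict _ DB) (count_in_restrict _ AB) count_in_restrictC.
    by case=> tD tA.
  by case=> -[].
rewrite PE; set b := (X in X%:E).
apply: (@le_trans _ _ (\int[P]_t cst b%:E t)).
  apply: ge0_le_integral_nonmeas => t _.
    apply: mule_ge0; last rewrite inve_ge0.
      by apply: integral_ge0 => xi _; exact: expeR_ge0.
    by apply: integral_ge0 => xi _; exact: expeR_ge0.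
  exact: (gibbs_kernel_le law).
rewrite integral_cst// le_eqVlt; apply/orP; left; apply/eqP.
transitivity (b%:E * 1); last exact: mule1.
by congr (_ * _); exact: probability_setT.
Qed.

(** The factor [exp (- lambda |D|)] for the emptiness of [D] beats the loss
    [exp (lambda |D| (1 - exp (- g)))] in the partition function. *)
Lemma gibbs_count_exp_moment d (T : measurableType d) (P : probability T R)
    (X : T -> config R) (lambda r gamma g c : R) D A : (0 <= lambda)%R -> (0 < r)%R ->
  gibbs_process P X lambda gamma (wr_energy r) ->
  measurable D -> measurable A -> bounded_set (D `|` A) -> D `&` A = set0 ->
  area D < +oo -> area A < +oo ->
  (`|gamma| * (4 * r ^+ 2) <= g)%R ->
  \sum_(0 <= k <oo) (expR (c * k%:R))%:E *
    P [set t | count_in D (X t) = 0 /\ count_in A (X t) = k%:R%:E] <=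
  (expR (lambda * (fine (area A) * expR (c + g) - fine (area D) * expR (- g))))%:E.
Proof.
move=> l0 r0 gibbs mD mA bB DA Dfin Afin hg.
pose a := fine (area A); pose b := fine (area D); pose e := fine (area (D `|` A)).
have g0 : (0 <= g)%R.
  by apply: (le_trans _ hg); rewrite mulr_ge0// mulr_ge0// sqr_ge0.
have DAfin : area (D `|` A) < +oo.
  by apply: le_lt_trans (area_setU_le mD mA) _; exact: lte_add_pinfty.
have eab : (e <= b + a)%R.
  rewrite -lee_fin EFinD.
  by rewrite (fineK (area_fin_num DAfin)) (fineK (area_fin_num Dfin))
    (fineK (area_fin_num Afin)) area_setU_le.
pose q := (expR (- (lambda * b)) * expR (lambda * e * (1 - expR (- g))))%R.
have q0 : (0 <= q)%R by rewrite mulr_ge0// expR_ge0.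
have pw0 k : (0 <= expR ((c + g) * k%:R) * poisson_weight (lambda * a) k)%R.
  rewrite !mulr_ge0 ?expR_ge0 ?exprn_ge0 ?invr_ge0//.
  by rewrite mulr_ge0// fine_area_ge0.
apply: (@le_trans _ _ (\sum_(0 <= k <oo)
    q%:E * (expR ((c + g) * k%:R) * poisson_weight (lambda * a) k)%:E)).
  apply: lee_nneseries => k; first by move=> _ _; rewrite mule_ge0 ?lee_fin ?expR_ge0.
  move=> _; apply: le_trans.
    apply: lee_wpmul2l; first by rewrite lee_fin expR_ge0.
    exact: (gibbs_count_probability k l0 r0 gibbs mD mA bB DA hg).
  rewrite -!EFinM lee_fin mulrDl expRD /q -/a -/b -/e le_eqVlt.
  by apply/orP; left; apply/eqP; ring.
rewrite nneseriesZl; last by move=> k _; rewrite lee_fin.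
rewrite poisson_exp_moment; last by rewrite mulr_ge0// fine_area_ge0.
rewrite -EFinM lee_fin /q -!expRD ler_expR -/a -/b.
have := ler_wpM2r (_ : 0 <= 1 - expR (- g))%R (ler_wpM2l l0 eab).
rewrite subr_ge0 -expR0 ler_expR oppr_le0 => /(_ g0); rewrite expR0.
have : (0 <= lambda * a * expR (- g))%R.
  by rewrite !mulr_ge0 ?expR_ge0 ?fine_area_ge0.
lra.
Qed.

(** The left-hand side is the exponent for the radii [n] and [n + 3], where
    [s^2 = (n + 3)^2 - n^2].  The inequality [x s <= x^2 / (4 e) + e s^2] reduces
    the term in [s] to a small multiple of [n^2] and a linear term. *)
Lemma parabola_beats_annulus (p q : R) : (0 < p)%R -> exists C : R,
  forall (n s : R), (0 <= n)%R -> (s ^+ 2 = 6 * n + 9)%R ->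
  (q * (n + 3) * s - p * n ^+ 2 <= C - n)%R.
Proof.
move=> p0; pose L := (12 * q ^+ 2 / p)%R.
exists (9 / 4 * p + 18 * q ^+ 2 / p + (L + 1) ^+ 2 / (3 * p))%R => n s n0 hs.
(* [(n + 3)^2 <= 2 n^2 + 18], so the first summand is at most [p n^2 / 4] plus a
   constant. *)
have h1 : (q * (n + 3) * s <= p / 8 * (n + 3) ^+ 2 + 2 * q ^+ 2 / p * (6 * n + 9))%R.
  rewrite -hs -subr_ge0 (_ : _ - _ = p / 8 * (n + 3 - 4 * q / p * s) ^+ 2)%R.
    by rewrite mulr_ge0 ?sqr_ge0// divr_ge0// ltW.
  by field; rewrite gt_eqF.
have h2 : (0 <= 3 * p / 4 * (n - 2 * (L + 1) / (3 * p)) ^+ 2)%R.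
  by rewrite mulr_ge0 ?sqr_ge0// divr_ge0// mulr_ge0// ltW.
have e2 : (3 * p / 4 * (n - 2 * (L + 1) / (3 * p)) ^+ 2 =
  3 * p / 4 * n ^+ 2 - (L + 1) * n + (L + 1) ^+ 2 / (3 * p))%R.
  by field; rewrite gt_eqF.
have e3 : (2 * q ^+ 2 / p * (6 * n + 9) = L * n + 18 * q ^+ 2 / p)%R.
  by rewrite /L; field; rewrite gt_eqF.
have h4 : (0 <= p * (n - 3) ^+ 2)%R by rewrite mulr_ge0 ?sqr_ge0// ltW.
rewrite e2 in h2; rewrite e3 in h1; nra.
Qed.

Lemma expR_series_lty (C : R) : \sum_(0 <= n <oo) (expR (C - n%:R))%:E < +oo.
Proof.
apply: le_lt_trans (ltry (2 * expR C)%R).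
apply: (@le_trans _ _ (\sum_(0 <= n <oo) (2 * expR C / (2 ^ n.+1)%:R)%:E)).
  apply: lee_nneseries => n _; rewrite lee_fin ?expR_ge0//.
  rewrite expRD natrX exprS invfM mulrACA divff// mul1r ler_wpM2l ?expR_ge0//.
  rewrite -mulN1r expRM_natr -exprVn lerXn2r ?nnegrE ?expR_ge0 ?invr_ge0//.
  rewrite expRN lef_pV2 ?posrE ?expR_gt0//.
  by have := expR_ge1Dx (1 : R); lra.
by apply: epsilon_trick0; rewrite mulr_ge0// expR_ge0.
Qed.

End GibbsCounts.

(** * Exponential moments of the length *)

Section Length.
Context {R : realType}.
Implicit Types (w : config R) (x y z : R * R) (A : set (R * R)).

Local Open Scope ereal_scope.

Definition annulus (n : nat) : set (R * R) := odisk (n%:R + 3)%R `\` odisk n%:R.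

Lemma expeR_mule_le (alpha b : R) (h : \bar R) : 0 <= h -> h <= b%:E ->
  expeR (alpha%:E * h) <= (expR (`|alpha| * b))%:E.
Proof.
case: h => [h||]//=; rewrite !lee_fin => h0 hb; rewrite ler_expR.
by apply: (@le_trans _ _ (`|alpha| * h)%R); rewrite ?ler_wpM2r ?ler_wpM2l// ler_norm.
Qed.

(** The integer [n] is the least one for which the open disk of radius [n + 1]
    contains a point; without any point the tessellation is empty. *)
Lemma expeR_length_cases (alpha : R) w
    (h := hausdorff1 (voronoi w `&` disk (0, 0)%R 1)) :
  expeR (alpha%:E * h) <= 1 \/ exists n k, [/\ count_in (odisk n%:R) w = 0,
    count_in (annulus n) w = k%:R%:E &
    expeR (alpha%:E * h) <= (expR (16 * `|alpha| * k%:R))%:E].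
Proof.
have LE b : h <= b%:E -> expeR (alpha%:E * h) <= (expR (`|alpha| * b))%:E.
  by apply: expeR_mule_le; exact: hausdorff1_ge0.
have [[x0 wx0]|w0] := pselect (exists x, points w x); last first.
  left; have := LE (16 * #|` fset_set (set0 : set (R * R))|%:R)%R.
  rewrite fset_set0 cardfs0 !mulr0 expR0; apply.
  have := @hausdorff1_voronoi_le R w set0 (points_lf w) (finite_set0 _).
  rewrite fset_set0 cardfs0 !mulr0; apply => // x z wx.
  by case: w0; exists x.
right.
have ex : exists n : nat, `[< exists2 x, points w x & odisk n.+1%:R x >].
  exists (Num.bound (sqnorm x0)); apply/asboolP; exists x0 => //.
  have := archi_boundP (sqnorm_ge0 x0); rewrite /odisk /= -natr1.
  have := sqnorm_ge0 x0; nra.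
case: (ex_minnP ex) => n /asboolP[y wy yn] nmin.
have D0 : points w `&` odisk n%:R = set0.
  apply/seteqP; split=> // x [wx]; case: n yn nmin => [|n] yn nmin xn.
    by move: xn; rewrite /odisk /= expr0n /= ltNge sqnorm_ge0.
  have : (n.+1 <= n)%N by apply: nmin; apply/asboolP; exists x.
  by rewrite ltnn.
have finA : finite_set (points w `&` annulus n).
  apply: points_lf; apply: bounded_set_sub (bounded_odisk (_ : 0 <= n%:R + 3)%R) => //.
  by move=> x [].
exists n, #|` fset_set (points w `&` annulus n)|; split.
- exact: count_in0.
- exact: count_in_card.
- rewrite (mulrC 16%R) -mulrA; apply: LE.
  apply: hausdorff1_voronoi_le => //; first exact: points_lf.
  move=> x z wx Cz z1; split=> //; split.
    have := nucleus_close (ler0n _ n.+1) wx wy yn Cz z1.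
    by rewrite -natr1 -addrA (_ : 1 + 2 = 3)%R//; ring.
  by move=> xn; have : (points w `&` odisk n%:R) x by []; rewrite D0.
Qed.

End Length.

Theorem proposition1p7 (R : realType) (d : measure_display)
    (T : measurableType d) (P : probability T R) (X : T -> config R)
    (lambda r gamma : R) :
  0 < lambda -> 0 < r ->
  widom_rowlinson P X lambda r gamma ->
  forall alpha : R,
    (\int[P]_t expeR (alpha%:E * hausdorff1 (voronoi (X t) `&` disk (0, 0)%R 1))
     < +oo)%E.
Proof.
move=> l0 r0 [mX _ _ gibbs] alpha.
pose c := 16 * `|alpha|; pose g := `|gamma| * (4 * r ^+ 2).
pose V n k := [set t | count_in (odisk n%:R) (X t) = 0%E /\
  count_in (annulus n) (X t) = k%:R%:E].
have mann n : measurable (annulus n : set (R * R)).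
  by apply: measurableD; exact: measurable_odisk.
have bann n : bounded_set (annulus n : set (R * R)).
  by apply: bounded_set_sub (bounded_odisk (_ : 0 <= n%:R + 3)) => // x [].
have mV n k : measurable (V n k).
  have mD : measurable (count_event (odisk n%:R) 0 : set (config R)).
    by apply: measurable_no_point; exact: measurable_odisk.
  have mA := measurable_count_event k (mann n) (bann n).
  by have := mX measurableT _ (measurableI _ _ mD mA); rewrite setTI.
pose f n k t : \bar R := ((expR (c * k%:R))%:E * (\1_(V n k) t)%:E)%E.
have f0 n k t : (0 <= f n k t)%E by rewrite mule_ge0 ?lee_fin ?expR_ge0.
have mf n k : measurable_fun setT (f n k).
  by apply: measurable_funeM; apply/measurable_EFinP; exact: measurable_indic.
have sf0 n t : (0 <= \sum_(0 <= k <oo) f n k t)%E by apply: nneseries_ge0.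
have msf n : measurable_fun setT (fun t => \sum_(0 <= k <oo) f n k t)%E.
  exact: ge0_emeasurable_sum.
(* For each [t] a single term of the double series, or the constant 1, already
   dominates the integrand. *)
apply: (@le_lt_trans _ _
  (\int[P]_t (1 + \sum_(0 <= n <oo) \sum_(0 <= k <oo) f n k t))%E).
  apply: ge0_le_integral_nonmeas => t _; first exact: expeR_ge0.
  have [L1|[n [k [tD tA Lk]]]] := expeR_length_cases alpha (X t).
    by apply: (le_trans L1); rewrite leeDl// nneseries_ge0.
  apply: (le_trans Lk); apply: (@le_trans _ _ (f n k t)).
    by rewrite /f indicE mem_set// mule1.
  apply: le_trans (nneseries_term_le k (fun k => f0 n k t)) _.
  apply: le_trans (nneseries_term_le n (fun n => sf0 n t)) _.
  by rewrite leeDr.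
rewrite ge0_integralD//; last 2 first.
  by move=> t _; apply: nneseries_ge0.
  exact: ge0_emeasurable_sum.
rewrite integral_nneseries//.
have intf n : (\int[P]_t \sum_(0 <= k <oo) f n k t =
    \sum_(0 <= k <oo) (expR (c * k%:R))%:E * P (V n k))%E.
  rewrite integral_nneseries//; apply: eq_eseriesr => k _.
  transitivity ((expR (c * k%:R))%:E * \int[P]_t (\1_(V n k) t)%:E)%E.
    have m1 : measurable_fun setT (fun t => (\1_(V n k) t)%:E : \bar R).
      by apply/measurable_EFinP; exact: measurable_indic.
    by apply: ge0_integralZl => // *; rewrite lee_fin ?expR_ge0.
  by rewrite integral_indic// setIT.
rewrite (_ : (\int[P]_t 1 = 1)%E); last first.
  transitivity (1 * P setT)%E; first exact: integral_cst.
  by rewrite mul1e; exact: probability_setT.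
apply: lte_add_pinfty; first exact: ltry.
have [C hC] := @parabola_beats_annulus R (lambda * expR (- g))
  (4 * lambda * expR (c + g)) (mulr_gt0 l0 (expR_gt0 _)).
apply: le_lt_trans (expR_series_lty C).
apply: lee_nneseries => n; first by move=> _ _; apply: integral_ge0 => t _.
move=> _; rewrite intf.
have nn3 : odisk (n%:R : R) `<=` odisk (n%:R + 3).
  move=> x; rewrite /odisk /= => /lt_le_trans; apply.
  by rewrite ler_sqr ?nnegrE// lerDl.
have DAE : odisk n%:R `|` annulus n = odisk (n%:R + 3 : R) by rewrite setDUK.
have DA0 : odisk (n%:R : R) `&` annulus n = set0 by rewrite setDIK.
have bDA : bounded_set (odisk (n%:R : R) `|` annulus n).
  by rewrite DAE; exact: bounded_odisk.
pose s := Num.sqrt (6 * n%:R + 9 : R).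
have s2 : s ^+ 2 = 6 * n%:R + 9 by rewrite sqr_sqrtr// addr_ge0// mulr_ge0.
have Dle := area_odisk_le (ler0n R n).
have Age : (area (annulus n) <= (4 * (n%:R + 3) * s)%:E)%E.
  by apply: area_annulus_le; rewrite ?sqrtr_ge0 ?addr_ge0// s2; lra.
have Dfin : (area (odisk (n%:R : R)) < +oo)%E by exact: le_lt_trans Dle (ltry _).
have Afin : (area (annulus n : set (R * R)) < +oo)%E by exact: le_lt_trans Age (ltry _).
apply: le_trans (gibbs_count_exp_moment c (ltW l0) r0 gibbs (measurable_odisk _)
  (mann n) bDA DA0 Dfin Afin (lexx _)) _.
rewrite lee_fin ler_expR; apply: le_trans (hC n%:R s (ler0n _ _) s2).
have Dn : n%:R ^+ 2 <= fine (area (odisk (n%:R : R))).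
  by rewrite -lee_fin fineK ?area_fin_num//; exact: area_odisk_ge.
have An : fine (area (annulus n)) <= 4 * (n%:R + 3) * s.
  by rewrite -lee_fin fineK ?area_fin_num.
have := ler_wpM2l (mulr_ge0 (ltW l0) (expR_ge0 (c + g))) An.
have := ler_wpM2l (mulr_ge0 (ltW l0) (expR_ge0 (- g))) Dn.
rewrite /g; lra.
Qed.
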